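(* Let $X$ be a second-countable well-filtered space (or equivalently, a second-countable sober space). Then: (1) the Scott topology agrees with the upper Vietoris topology on $\mathsf{K}(X)$; (2) the Scott power space $\Sigma\,\mathsf{K}(X)$ of $X$ is a second-countable sober space.
   Context: A subset of a $T_0$ space $X$ is saturated if it equals the intersection of all open sets containing it. $\mathsf{K}(X)$ denotes the set of all nonempty compact saturated subsets of $X$, ordered by the Smyth order $K_1\sqsubseteq K_2 \iff K_2\subseteq K_1$. The upper Vietoris topology on $\mathsf{K}(X)$ has base $\{\Box U: U \text{ open in } X\}$, where $\Box U=\{K\in\mathsf{K}(X):K\subseteq U\}$. For a poset $P$, a subset $U$ is Scott open if $U$ is an upper set and for every (nonempty) directed $D\subseteq P$ whose supremum $\bigvee D$ exists in $P$, $\bigvee D\in U$ implies $D\cap U\neq\emptyset$; these sets form the Scott topology $\sigma(P)$, and $\Sigma P=(P,\sigma(P))$. The Scott power space of $X$ is $\Sigma\,\mathsf{K}(X)=(\mathsf{K}(X),\sigma(\mathsf{K}(X)))$. A $T_0$ space $X$ is well-filtered if for every filtered family $\mathcal K\subseteq \mathsf{K}(X)$ (nonempty, any two members contain a common third member) and every open $U$, $\bigcap\mathcal K\subseteq U$ implies $K\subseteq U$ for some $K\in\mathcal K$. Sober: every irreducible closed subset is the closure of a unique point. *)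

(* Defs.v *)
From HB Require Import structures.
From mathcomp Require Import all_boot all_order.
From mathcomp Require Import all_classical.
From mathcomp Require Import topology_structure compact separation_axioms.

Set Implicit Arguments.
Unset Strict Implicit.
Unset Printing Implicit Defensive.

Import Order.TTheory.
Local Open Scope classical_set_scope.
Local Open Scope order_scope.

#[global] Arguments second_countable T : clear implicits.

Definition saturated (X : topologicalType) (A : set X) : Prop :=
  A = \bigcap_(U in [set U : set X | open U /\ A `<=` U]) U.

Definition irreducible_set (X : topologicalType) (A : set X) : Prop :=
  A !=set0 /\
  forall B C : set X, closed B -> closed C ->
    A `<=` B `|` C -> A `<=` B \/ A `<=` C.

(* The uniqueness of the generic point makes every sober space T0. *)
Definition sober_space (X : topologicalType) : Prop :=
  forall A : set X, closed A -> irreducible_set A ->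
    exists! x : X, A = closure [set x].

Record compact_sat (X : topologicalType) := CompactSat {
  compact_sat_set :> set X;
  compact_satP_subproof :
    `[< [/\ compact_sat_set !=set0, compact compact_sat_set
          & saturated compact_sat_set] >] }.

Section CompactSatOrder.
Context (X : topologicalType).

HB.instance Definition _ := [isSub for @compact_sat_set X].
HB.instance Definition _ := [Choice of compact_sat X by <:].

Lemma compact_satP (K : compact_sat X) :
  [/\ (K : set X) !=set0, compact K & saturated K].
Proof. exact/asboolP/compact_satP_subproof. Qed.

Definition smyth_le (K1 K2 : compact_sat X) : bool := `[< K2 `<=` K1 >].

Lemma smyth_le_refl : reflexive smyth_le.
Proof. by move=> K; apply/asboolP. Qed.

Lemma smyth_le_anti : antisymmetric smyth_le.
Proof.
move=> K1 K2 /andP[/asboolP K21 /asboolP K12].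
by apply: val_inj; apply/seteqP; split.
Qed.

Lemma smyth_le_trans : transitive smyth_le.
Proof.
move=> K2 K1 K3 /asboolP K21 /asboolP K32; apply/asboolP.
exact: subset_trans K32 K21.
Qed.

Fact smyth_display : Order.disp_t. Proof. exact: Order.Disp tt tt. Qed.

HB.instance Definition _ := Order.Le_isPOrder.Build smyth_display
  (compact_sat X) smyth_le_refl smyth_le_anti smyth_le_trans.

Lemma smyth_leP (K1 K2 : compact_sat X) : K1 <= K2 <-> K2 `<=` K1.
Proof. by split=> /asboolP. Qed.

End CompactSatOrder.

Definition filtered_family (X : topologicalType) (F : set (compact_sat X)) :
    Prop :=
  F !=set0 /\
  forall K1 K2 : compact_sat X, F K1 -> F K2 ->
    exists2 K3 : compact_sat X, F K3 & K3 `<=` K1 /\ K3 `<=` K2.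

Definition well_filtered_space (X : topologicalType) : Prop :=
  kolmogorov_space X /\
  forall (F : set (compact_sat X)) (U : set X),
    filtered_family F -> open U ->
    \bigcap_(K in F) (K : set X) `<=` U ->
    exists2 K : compact_sat X, F K & K `<=` U.

Section ScottTopology.
Context (d : Order.disp_t) (P : porderType d).

Definition directed_set (D : set P) : Prop :=
  D !=set0 /\
  forall x y : P, D x -> D y -> exists2 z : P, D z & x <= z /\ y <= z.

Definition scott_open (U : set P) : Prop :=
  (forall x y : P, U x -> x <= y -> U y) /\
  (forall (D : set P) (s : P), directed_set D -> isLub D s -> U s ->
    D `&` U !=set0).

Lemma scott_openT : scott_open setT.
Proof. by split=> // D s [[x Dx] _] _ _; exists x. Qed.

Lemma scott_openI : setI_closed scott_open.
Proof.
move=> U V [upU sU] [upV sV]; split.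
  by move=> x y [Ux Vx] xy; split; [exact: upU xy|exact: upV xy].
move=> D s dD Ds [Us Vs].
have [x [Dx Ux]] := sU _ _ dD Ds Us.
have [y [Dy Vy]] := sV _ _ dD Ds Vs.
have [z Dz [xz yz]] := dD.2 _ _ Dx Dy.
by exists z; split=> //; split; [exact: upU xz|exact: upV yz].
Qed.

Lemma scott_open_bigcup (I : Type) (f : I -> set P) :
  (forall i, scott_open (f i)) -> scott_open (\bigcup_i f i).
Proof.
move=> sf; split.
  by move=> x y [i _ fx] xy; exists i => //; apply: (sf i).1 xy.
move=> D s dD Ds [i _ fs].
have [x [Dx fx]] := (sf i).2 _ _ dD Ds fs.
by exists x; split=> //; exists i.
Qed.

(* Alias of P carrying the Scott topology. *)
Definition scott_space : Type := P.

HB.instance Definition _ := Choice.on scott_space.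
HB.instance Definition _ := isOpenTopological.Build scott_space
  scott_openT scott_openI scott_open_bigcup.

Definition scott_topology : set (set P) := @open scott_space.

End ScottTopology.

#[global] Arguments scott_topology {d} P.

Section UpperVietoris.
Context (X : topologicalType).

Definition box (U : set X) : set (compact_sat X) := [set K | K `<=` U].

Lemma box_cover : \bigcup_(U in @open X) box U = setT.
Proof.
by apply/seteqP; split=> // K _; exists setT; [exact: openT|].
Qed.

Lemma box_join (U V : set X) (K : compact_sat X) :
  open U -> open V -> box U K -> box V K ->
  exists W : set X, [/\ open W, box W K & box W `<=` box U `&` box V].
Proof.
move=> oU oV KU KV; exists (U `&` V); split; first exact: openI.
- by move=> x Kx; split; [exact: KU|exact: KV].
- by move=> L LUV; split=> x /LUV[].
Qed.

(* Alias of compact_sat X carrying the upper Vietoris topology. *)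
Definition upper_vietoris : Type := compact_sat X.

HB.instance Definition _ := Choice.on upper_vietoris.
HB.instance Definition _ := isBaseTopological.Build upper_vietoris
  box_cover box_join.

Definition upper_vietoris_topology : set (set (compact_sat X)) :=
  @open upper_vietoris.

End UpperVietoris.

#[global] Arguments upper_vietoris_topology X : clear implicits.

Definition scott_power_space (X : topologicalType) : topologicalType :=
  scott_space (compact_sat X).

(* Main.v *)
Require Import Defs.
From mathcomp Require Import all_boot all_order.
From mathcomp Require Import all_classical.
From mathcomp Require Import topology_structure compact separation_axioms.

Set Implicit Arguments.
Unset Strict Implicit.
Unset Printing Implicit Defensive.

Local Open Scope classical_set_scope.

(** Everything rests on one observation about sequences
    ([irreducible_cvg]): in a second-countable space, an irreducible set C lying
    in the closure of S admits a single sequence of points of S that converges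
    to all points of C at once.  Indeed the open sets meeting C are closed under
    finite intersection, so the n-th point can be taken in S and in all of the
    first n basic open sets that meet C.  The upper Vietoris space of a
    second-countable X is again second-countable, its base being the boxes of
    finite unions of basic open sets, so the observation applies there too.

    A sequence of compact saturated sets K_m converging to Q in the upper
    Vietoris topology has compact saturated tails
    L_n = Q + K_n + K_(n+1) + ..., decreasing in n
    ([limit_tail_compact_sat]): an open set covering Q covers almost all K_m,
    and finitely many compact sets remain.

    - Scott open sets are Vietoris open.  If a Scott open A is not a Vietoris
      neighbourhood of some Q in A, some K_m outside A converge to Q.  The
      tails L_n are directed with supremum Q, so some L_n lies in A, hence so
      does K_n, which is contained in it.  Conversely, in a well-filtered space
      directed suprema in K(X) are intersections, so boxes are Scott open by
      well-filteredness.

    - Sobriety.  Let K_m lie in an irreducible closed set and converge to all of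
      its points, in particular to each K_n.  If X is well-filtered, the
      intersection Q of the tails is compact saturated and an open U contains Q
      exactly when it contains almost all K_m ([upper_limit_exists]).  Such a Q
      is the generic point in the upper Vietoris space.  Applied to the
      principal sets of points x_m of an irreducible closed A of X, the same
      lemma gives a Q meeting A, and any point of Q in A is generic.  This
      proves that a second-countable well-filtered space is sober.

    - Sober spaces are well-filtered by the topological Rudin lemma: if no member
      of a filtered family F lies in the open set U, a minimal closed set
      disjoint from U and meeting all members of F is irreducible, and its
      generic point belongs to every member of F but not to U. *)

(** * The specialization order, saturation and compactness *)

(** Membership of a in the closure of x is the specialization order, a below x. *)
Lemma closure1P (X : topologicalType) (x a : X) :
  closure [set x] a <-> forall U : set X, open U -> U a -> U x.
Proof.
split=> [xa U oU Ua|xa B]; last first.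
  by rewrite nbhsE => -[U [oU Ua] UB]; exists x; split=> //; exact/UB/(xa U).
by have [_ [-> ?]] := xa U (open_nbhs_nbhs (conj oU Ua)).
Qed.

Lemma closureP (X : topologicalType) (A : set X) (x : X) :
  closure A x <-> forall U : set X, open U -> U x -> A `&` U !=set0.
Proof.
split=> [Ax U oU Ux|Ax B]; first exact/Ax/open_nbhs_nbhs.
rewrite nbhsE => -[U [oU Ux] UB].
by have [a [Aa Ua]] := Ax U oU Ux; exists a; split=> //; exact: UB.
Qed.

Lemma closure1_subset (X : topologicalType) (A : set X) (x : X) :
  closed A -> A x -> closure [set x] `<=` A.
Proof. by move=> cA Ax y xy; apply: cA => B /xy[_ [-> Bx]]; exists x. Qed.

Lemma closure1_eq (X : topologicalType) (x y : X) :
  closure [set x] y -> closure [set y] x -> closure [set x] = closure [set y].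
Proof.
by move=> xy yx; apply/seteqP; split; apply: closure1_subset => //;
  exact: closed_closure.
Qed.

Lemma irreducible_closure1 (X : topologicalType) (x : X) :
  irreducible_set (closure [set x]).
Proof.
split=> [|B C cB cC xBC]; first by exists x; exact: subset_closure.
by have [Bx|Cx] := xBC x (subset_closure erefl); [left|right];
  exact: closure1_subset.
Qed.

Lemma kolmogorovP (X : topologicalType) :
  kolmogorov_space X <->
  forall x y : X, closure [set x] = closure [set y] -> x = y.
Proof.
split=> [T0 x y xy|T0 x y /eqP nxy].
  apply/eqP/negP => /negP /T0[A].
  have [xy1 yx1] : closure [set x] y /\ closure [set y] x.
    by split; [rewrite xy|rewrite -xy]; exact: subset_closure.
  case=> -[/set_mem nA /set_mem]; apply.
    by have [_ [-> ]] := yx1 A nA.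
  by have [_ [-> ]] := xy1 A nA.
apply: contrapT => nsep; apply: nxy; apply: T0; apply: closure1_eq;
  apply/closure1P => U oU Ua; apply: contrapT => nU; apply: nsep; exists U;
  [right|left]; split; apply/mem_set => //; exact: open_nbhs_nbhs.
Qed.

(** The complement of the closure of x is the largest open set that misses x, so
    one open set decides whether x belongs to every open set around A. *)
Lemma saturatedP (X : topologicalType) (A : set X) :
  saturated A <-> forall a x : X, A a -> closure [set x] a -> A x.
Proof.
split=> [-> a x Aa /closure1P xa U [oU AU]|upA];
  first exact: (xa U oU (Aa U (conj oU AU))).
apply/seteqP; split=> [a Aa U [_]|x Ax]; first exact.
apply: contrapT => nAx.
have : ~ closure [set x] x.
  apply: (Ax (~` closure [set x])); split.
    by rewrite openC; exact: closed_closure.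
  by move=> a Aa xa; exact/nAx/(upA a).
by apply; exact: subset_closure.
Qed.

Lemma saturated_notin (X : topologicalType) (A : set X) (x : X) :
  saturated A -> ~ A x -> exists U : set X, [/\ open U, A `<=` U & ~ U x].
Proof.
move=> sA nAx; apply: contrapT => nU; apply: nAx; rewrite sA => U [oU AU].
by apply: contrapT => nUx; apply: nU; exists U.
Qed.

(** * Compactness by directed covers *)

Definition directed_family (T : Type) (W : set (set T)) : Prop :=
  W !=set0 /\
  forall U V, W U -> W V -> exists2 Z, W Z & U `<=` Z /\ V `<=` Z.

(** With directed covers, one member replaces the finite subcover.  A directed
    cover without a member containing A yields the
    filter generated by the sets A minus U, which has no cluster point in A;
    conversely, a filter on A without cluster point in A yields the directed
    cover of A by the open sets whose complement is in the filter. *)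
Lemma compactP (X : topologicalType) (A : set X) :
  compact A <->
  forall W : set (set X), W `<=` open -> directed_family W ->
    A `<=` \bigcup_(U in W) U -> exists2 U, W U & A `<=` U.
Proof.
split=> [cA W oW [[W0 WW0] dW] AW|cA F PF FA].
  apply: contrapT => nW.
  pose F := [set S : set X | exists2 U, W U & A `\` U `<=` S].
  have PF : ProperFilter F.
    apply: Build_ProperFilter_ex => [S [U WU US]|].
      apply: contrapT => nS; apply: nW; exists U => // a Aa.
      by apply: contrapT => nUa; apply: nS; exists a; exact: US.
    split=> [|S T [U WU US] [V WV VT]|S T ST [U WU US]].
    - by exists W0.
    - have [Z WZ [UZ VZ]] := dW U V WU WV; exists Z => // a [Aa nZa].
      by split; [apply: US; split=> // /UZ|apply: VT; split=> // /VZ].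
    - by exists U => //; exact: subset_trans US ST.
  have FA : F A by exists W0 => // a [].
  have [p [Ap clp]] := cA F PF FA.
  have [U WU Up] := AW p Ap.
  have FU : F (A `\` U) by exists U.
  have [q [[_ nUq] Uq]] := clp _ _ FU (open_nbhs_nbhs (conj (oW _ WU) Up)).
  exact: nUq.
apply: contrapT => nA.
pose W := [set U : set X | open U /\ F (~` U)].
have [|||U [_ FU] AU] := cA W.
- by move=> U [].
- split=> [|U V [oU FU] [oV FV]].
    by exists set0; split; [exact: open0|rewrite setC0; exact: filterT].
  exists (U `|` V); last by split=> x; [left|right].
  by split; [exact: openU|rewrite setCU; exact: filterI].
- move=> p Ap; apply: contrapT => nWp; apply: nA; exists p; split=> // S B FS.
  rewrite nbhsE => -[U [oU Up] UB]; apply: contrapT => nSB; apply: nWp.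
  exists U => //; split=> //; apply: filterS FS => x Sx Ux.
  by apply: nSB; exists x; split=> //; exact: UB.
have [x [Ax nUx]] := filter_ex (filterI FA FU).
exact/nUx/AU.
Qed.

Lemma compact_sat_exists (X : topologicalType) (A : set X) :
  A !=set0 -> compact A -> saturated A ->
  exists K : compact_sat X, K = A :> set X.
Proof.
move=> A0 cA sA.
by have h : `[< [/\ A !=set0, compact A & saturated A] >] by [apply/asboolP];
  exists (CompactSat h).
Qed.

(** The principal upper set of a point; a directed open cover of it needs only
    the member that contains the point. *)
Lemma principal_exists (X : topologicalType) (x : X) :
  exists K : compact_sat X, forall y, (K : set X) y <-> closure [set y] x.
Proof.
have [||| K KE] := @compact_sat_exists X [set y | closure [set y] x].
- by exists x; exact: subset_closure.
- apply/compactP => W oW _ xW.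
  have [U WU Ux] := xW x (subset_closure erefl).
  by exists U => // y /closure1P; apply=> //; exact: oW.
- apply/saturatedP => a y /closure1P ax /closure1P ya.
  by apply/closure1P => U oU /(ax _ oU); exact: ya.
by exists K => y; rewrite KE.
Qed.

(** * Well-filtered and sober spaces *)

(** Well-filteredness gives each defining property of a compact saturated set:
    nonemptiness from the empty open set, compactness from the union of a
    directed cover. *)
Lemma well_filtered_bigcap (X : topologicalType) (F : set (compact_sat X)) :
  well_filtered_space X -> filtered_family F ->
  exists Q : compact_sat X, Q = \bigcap_(K in F) (K : set X) :> set X.
Proof.
move=> [_ wf] fF; apply: compact_sat_exists.
- apply: contrapT => /set0P/negP; rewrite negbK => /eqP F0.
  have [|K _] := wf F set0 fF open0; first by rewrite F0.
  by have [[x Kx] _ _] := compact_satP K => /(_ x Kx).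
- apply/compactP => W oW dW FW.
  have [|K FK KW] := wf F _ fF _ FW; first exact: bigcup_open.
  have [_ /compactP cK _] := compact_satP K.
  have [U WU KU] := cK W oW dW KW.
  by exists U => // x /(_ K FK) /KU.
- apply/saturatedP => a x Fa xa K FK.
  have [_ _ /saturatedP sK] := compact_satP K.
  exact: sK (Fa K FK) xa.
Qed.

Lemma sober_kolmogorov (X : topologicalType) :
  sober_space X -> kolmogorov_space X.
Proof.
move=> sX; apply/kolmogorovP => x y xy.
have [z [_ zu]] := sX _ (@closed_closure _ _) (irreducible_closure1 x).
by rewrite -(zu x erefl) -(zu y xy).
Qed.

(** The topological Rudin lemma followed by sobriety: a closed set that is
    minimal among those disjoint from U and meeting every member of F is
    irreducible, since two proper closed parts would each be missed by a member
    of F, and a common lower bound of these two would miss the whole set. *)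
Lemma sober_well_filtered (X : topologicalType) :
  sober_space X -> well_filtered_space X.
Proof.
move=> sX; split=> [|F U [[K0 FK0] fF] oU FU]; first exact: sober_kolmogorov.
apply: contrapT => nFU.
(* Zorn is applied to the complement of the closed set sought; joining U in the
   condition makes the empty chain admissible and forces a maximal O to
   contain U. *)
pose P := [set O : set X | open O /\
  forall K, F K -> ~ (K : set X) `<=` U `|` O].
have [C CP totC|O [[oO nO] maxO]] := @Zorn_bigcup X P.
  split=> [|K FK KUC]; first by apply: bigcup_open => O /CP[].
  have [_ /compactP cK _] := compact_satP K.
  have [C0|/set0P/negP] := pselect (C !=set0); last first.
    rewrite negbK => /eqP C0; apply: nFU; exists K => //.
    by move: KUC; rewrite C0 bigcup_set0 setU0.
  have [|||_ [O CO <-] KO] := cK [set U `|` O | O in C].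
  - by move=> _ [O /CP[oO _] <-]; exact: openU.
  - split=> [|_ _ [O1 C1 <-] [O2 C2 <-]].
      by have [O CO] := C0; exists (U `|` O), O.
    have [O12|O21] := totC _ _ C1 C2.
      by exists (U `|` O2); [exists O2|split; apply: setUS].
    by exists (U `|` O1); [exists O1|split; apply: setUS].
  - have [O0 CO0] := C0 => x /KUC[Ux|[O CO Ox]].
      by exists (U `|` O0); [exists O0|left].
    by exists (U `|` O); [exists O|right].
  by have [_ /(_ K FK)] := CP O CO.
(* Maximality of O: a strictly larger open set swallows some member of F. *)
have big V : open V -> ~ V `<=` O ->
    exists2 K : compact_sat X, F K & K `<=` U `|` (O `|` V).
  move=> oV nVO; apply: contrapT => nK; apply: (maxO (O `|` V)).
    by rewrite properEneq; split; [apply/eqP => OE; apply: nVO; rewrite OE|];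
      exact: subsetUl || exact: subsetUr.
  by split=> [|K FK KV]; [exact: openU|apply: nK; exists K].
have UO : U `<=` O.
  apply: contrapT => /(big _ oU)[K FK]; rewrite setUCA setUid setUC.
  exact: nO.
have UOV V : U `|` (O `|` V) = O `|` V.
  by rewrite setUA ((setUidPr _ _).2 UO).
have cA : closed (~` O) by rewrite closedC.
have iA : irreducible_set (~` O).
  split=> [|B C cB cC OBC].
    apply: contrapT => nA; apply: (nO K0 FK0) => x _; right.
    by apply: contrapT => nOx; apply: nA; exists x.
  apply: contrapT => /not_orP[nB nC].
  have [||K1 FK1 K1B] := big (~` B); [by rewrite openC|by move/subsetCl|].
  have [||K2 FK2 K2C] := big (~` C); [by rewrite openC|by move/subsetCl|].
  have [K3 FK3 [K31 K32]] := fF K1 K2 FK1 FK2.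
  apply: (nO K3 FK3) => x K3x; right.
  move: (K1B x (K31 x K3x)) (K2C x (K32 x K3x)); rewrite !UOV.
  move=> [//|nBx] [//|nCx]; apply: contrapT => nOx.
  by have [] := OBC x nOx.
have [x [Ax _]] := sX _ cA iA.
have : (~` O) x by rewrite Ax; exact: subset_closure.
apply; apply/UO/FU => K FK.
have [_ _ /saturatedP sK] := compact_satP K.
have [y [Ky nOy]] : exists y, (K : set X) y /\ ~ O y.
  apply: contrapT => nKO; apply: (nO K FK) => y Ky; right.
  by apply: contrapT => nOy; apply: nKO; exists y.
by apply: (sK y) => //; rewrite -Ax.
Qed.

(** * Sequences in second-countable spaces *)

Definition base_seq (X : topologicalType) (V : nat -> set X) : Prop :=
  (forall n, open (V n)) /\
  forall (x : X) (U : set X), open U -> U x ->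
    exists2 n, V n x & V n `<=` U.

(** With f injecting the base B into the naturals, the n-th open set is the union
    of the members of B of index n, hence a single member or empty. *)
Lemma second_countableP (X : topologicalType) :
  second_countable X <-> exists V : nat -> set X, base_seq V.
Proof.
split=> [[B /countable_injP[f fI] [oB bB]]|[V [oV bV]]].
  exists (fun n => \bigcup_(U in [set U | B U /\ f U = n]) U); split.
    by move=> n; apply: bigcup_open => U [/oB].
  move=> x U oU Ux.
  have [W [BW Wx] WU] := bB x U (open_nbhs_nbhs (conj oU Ux)).
  exists (f W) => [|y [W' [BW' fW'] W'y]]; first by exists W.
  by apply: WU; rewrite -(fI W' W) //; exact/mem_set.
exists (range V); first exact: card_image_le.
split=> [_ [n _ <-] //|x S].
rewrite nbhsE => -[U [oU Ux] US]; have [n Vx VU] := bV x U oU Ux.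
by exists (V n); [split=> //; exists n|exact: subset_trans US].
Qed.

(** Irreducibility of C says that open sets meeting C are stable under finite
    intersections, so some point of S lies in all of the first n basic open sets
    that meet C.  For C an irreducible closed set and S = C this produces a
    candidate generic sequence; for C the closure of a point it says that the
    closure is computed by sequences. *)
Lemma irreducible_cvg (X : topologicalType) (C S : set X) :
  second_countable X -> irreducible_set C -> C `<=` closure S ->
  exists x : nat -> X, (forall n, S (x n)) /\
    forall (c : X) (U : set X), C c -> open U -> U c ->
      \forall n \near \oo, U (x n).
Proof.
move=> /second_countableP[V [oV bV]] [C0 iC] CS.
have meetI U W : open U -> open W -> C `&` U !=set0 -> C `&` W !=set0 ->
    C `&` (U `&` W) !=set0.
  move=> oU oW [u [Cu Uu]] [w [Cw Ww]]; apply: contrapT => nUW.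
  have [||c Cc||] := iC (~` U) (~` W).
  - by rewrite closedC.
  - by rewrite closedC.
  - apply: contrapT => /not_orP[/contrapT Uc /contrapT Wc].
    by apply: nUW; exists c.
  - by move/(_ u Cu); apply.
  - by move/(_ w Cw); apply.
have common n : exists G : set X, [/\ open G, C `&` G !=set0 &
    forall i, (i < n)%N -> C `&` V i !=set0 -> G `<=` V i].
  elim: n => [|n [G [oG CG GV]]].
    by exists setT; split=> //; [exact: openT|rewrite setIT].
  have [CV|nCV] := pselect (C `&` V n !=set0).
    exists (G `&` V n); split; [exact: openI|exact: meetI|move=> i].
    rewrite ltnS leq_eqVlt => /orP[/eqP -> _|ilt Ci x [Gx _]].
      exact: subIsetr.
    exact: GV Gx.
  exists G; split=> // i; rewrite ltnS leq_eqVlt => /orP[/eqP ->//|].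
  exact: GV.
have pick n : exists x : X, S x /\
    forall i, (i < n)%N -> C `&` V i !=set0 -> V i x.
  have [G [oG [c [Cc Gc]] GV]] := common n.
  have /closureP/(_ G oG Gc)[x [Sx Gx]] := CS c Cc.
  by exists x; split=> // i ilt Ci; exact: GV Gx.
have [x xP] := choice pick.
exists x; split=> [n|c U Cc oU Uc]; first exact: (xP n).1.
have [i Vc VU] := bV c U oU Uc.
exists i.+1 => // n /= ilt; apply: VU.
by apply: (xP n).2 => //; exists c.
Qed.

(** * Convergent sequences of compact saturated sets *)

(** Convergence for the upper Vietoris topology, spelled out on its basic open
    sets. *)
Definition upper_cvg (X : topologicalType) (K : nat -> compact_sat X)
    (Q : compact_sat X) : Prop :=
  forall U : set X, open U -> Q `<=` U ->
    \forall n \near \oo, (K n : set X) `<=` U.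

Definition limit_tail (X : topologicalType) (Q : compact_sat X)
    (K : nat -> compact_sat X) (n : nat) : set X :=
  Q `|` \bigcup_(m in [set m | (n <= m)%N]) K m.

Lemma limit_tail_decr (X : topologicalType) (Q : compact_sat X)
    (K : nat -> compact_sat X) (m n : nat) :
  (m <= n)%N -> limit_tail Q K n `<=` limit_tail Q K m.
Proof.
move=> mn; apply: setUS => x [k /= nk Kx]; exists k => //=.
exact: leq_trans nk.
Qed.

(** A member U of a directed cover that contains Q contains all K m from some N
    on; finitely many enlargements of U then absorb the K m with m below N. *)
Lemma limit_tail_compact_sat (X : topologicalType) (Q : compact_sat X)
    (K : nat -> compact_sat X) (n : nat) :
  upper_cvg K Q -> exists L : compact_sat X, L = limit_tail Q K n :> set X.
Proof.
move=> KQ; have [[q Qq] /compactP cQ sQ] := compact_satP Q.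
apply: compact_sat_exists.
- by exists q; left.
- apply/compactP => W oW dW LW.
  have [|U WU QU] := cQ W oW dW; first by move=> x Qx; apply: LW; left.
  have [N _ KU] := KQ U (oW _ WU) QU.
  have head k : exists2 Z, W Z & U `<=` Z /\
      forall m, (n <= m < n + k)%N -> (K m : set X) `<=` Z.
    elim: k => [|k [Z WZ [UZ KZ]]].
      exists U => //; split=> // m; rewrite addn0.
      by case: leqP => //= nm; rewrite ltnNge nm.
    have [_ /compactP cK _] := compact_satP (K (n + k)%N).
    have [|Y WY KY] := cK W oW dW.
      by move=> x Kx; apply: LW; right; exists (n + k)%N => //=; exact: leq_addr.
    have [T WT [ZT YT]] := dW.2 Z Y WZ WY.
    exists T => //; split=> [|m]; first exact: subset_trans ZT.
    rewrite addnS ltnS => /andP[nm]; rewrite leq_eqVlt => /orP[/eqP ->|mlt].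
      exact: subset_trans YT.
    by apply: subset_trans ZT; apply: KZ; rewrite nm.
  have [Z WZ [UZ KZ]] := head N; exists Z => // x [Qx|[m /= nm Kx]].
    exact/UZ/QU.
  have [Nm|mN] := leqP N m; first exact/UZ/(KU m).
  by apply: (KZ m) => //; rewrite nm; exact: leq_trans (leq_addl _ _).
- apply/saturatedP => a x [Qa|[m nm Ka]] xa.
    by left; apply: (saturatedP Q).1 Qa xa.
  have [_ _ /saturatedP sK] := compact_satP (K m).
  by right; exists m => //; exact: sK Ka xa.
Qed.

(** Q is the intersection of the tails.  Each tail is compact because K n is one
    of the limits of the sequence, so that the tail from n on is its own limit
    tail for that limit. *)
Lemma upper_limit_exists (X : topologicalType) (K : nat -> compact_sat X) :
  well_filtered_space X -> (forall n, upper_cvg K (K n)) ->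
  exists Q : compact_sat X, forall U : set X, open U ->
    Q `<=` U <-> \forall n \near \oo, (K n : set X) `<=` U.
Proof.
move=> wf KK.
have [L LE] := choice (fun n => limit_tail_compact_sat n (KK n)).
have LK n x : (L n : set X) x <-> exists2 m, (n <= m)%N & (K m : set X) x.
  rewrite LE; split=> [[Kx|[m nm Kx]]|[m nm Kx]]; last by right; exists m.
    by exists n.
  by exists m.
have decr m n : (m <= n)%N -> L n `<=` L m.
  by move=> mn x /LK[k nk Kx]; apply/LK; exists k => //; exact: leq_trans nk.
have fL : filtered_family (range L).
  split=> [|_ _ [m _ <-] [n _ <-]]; first by exists (L 0%N), 0%N.
  exists (L (maxn m n)); first by exists (maxn m n).
  by split; apply: decr; [exact: leq_maxl|exact: leq_maxr].
have [Q QE] := well_filtered_bigcap wf fL.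
exists Q => U oU; rewrite QE; split=> [QU|[N _ KU] x Lx].
  have [_ [n _ <-] LU] := wf.2 _ U fL oU QU.
  by exists n => // m /= nm x Kx; apply/LU/LK; exists m.
have /LK[m Nm Kx] : (L N : set X) x by apply: (Lx (L N)); exists N.
exact: KU Nm _ Kx.
Qed.

(** A sequence in A that converges to all of A has principal upper sets with a
    limit Q as above; Q meets A since no principal set lies in the complement of
    A, and each open set around a point of A contains Q. *)
Lemma well_filtered_sober (X : topologicalType) :
  second_countable X -> well_filtered_space X -> sober_space X.
Proof.
move=> scX wf A cA iA.
have [x [Ax xA]] := irreducible_cvg scX iA (@subset_closure _ A).
have [K KE] := choice (fun n => principal_exists (x n)).
have KU n (U : set X) : open U -> (K n : set X) `<=` U <-> U (x n).
  move=> oU; split=> [KU|Ux y /KE/closure1P]; last exact.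
  exact/KU/KE/subset_closure.
have [n U oU /(KU _ _ oU) Ux|Q QU] := @upper_limit_exists _ K wf.
  by apply: filterS (xA _ U (Ax n) oU Ux) => m /(KU _ _ oU).
have [a [Qa Aa]] : exists a, (Q : set X) a /\ A a.
  apply: contrapT => nQA.
  have /QU[] : Q `<=` ~` A by move=> y Qy Ay; apply: nQA; exists y.
    by rewrite openC.
  by move=> N _ /(_ N (leqnn N)) /KU; rewrite openC => /(_ cA); apply.
have AE : A = closure [set a].
  apply/seteqP; split=> [b Ab|]; last exact: closure1_subset.
  apply/closure1P => U oU Ub; have : Q `<=` U; last exact.
  apply/(QU U oU); apply: filterS (xA b U Ab oU Ub) => m; exact: (KU _ _ oU).2.
by exists a; split=> // b; rewrite AE; exact: (kolmogorovP X).1 wf.1 _ _.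
Qed.

(** * The upper Vietoris space *)

Lemma open_upper_vietorisP (X : topologicalType) (A : set (upper_vietoris X)) :
  open A <->
  forall K : compact_sat X, A K ->
    exists U : set X, [/\ open U, box U K & box U `<=` A].
Proof.
split=> [[D oD <-] K [U DU KU]|bA].
  by exists U; split=> [||L LU]; [exact: oD|by []|exists U].
exists [set U | open U /\ box U `<=` A]; first by move=> U [].
apply/seteqP; split=> [K [U [_ UA] /UA]//|K /bA[U [oU KU UA]]].
by exists U.
Qed.

Lemma open_box (X : topologicalType) (U : set X) :
  open U -> @open (upper_vietoris X) (box U).
Proof. by move=> oU; apply/open_upper_vietorisP => K KU; exists U; split=> //. Qed.

Lemma closure1_upper_vietoris (X : topologicalType) (K L : upper_vietoris X) :
  closure [set K] L <-> (K : compact_sat X) `<=` (L : compact_sat X).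
Proof.
split=> [/closure1P KL x Kx|KL].
  apply: contrapT => nLx; have [_ _ sL] := compact_satP L.
  have [U [oU LU nUx]] := saturated_notin sL nLx.
  by apply/nUx/(KL _ (open_box oU)).
apply/closure1P => W /open_upper_vietorisP oW /oW[U [oU LU UW]].
by apply: UW; exact: subset_trans LU.
Qed.

(** A compact set inside U fits in a finite union of basic open sets inside U. *)
Lemma upper_vietoris_second_countable (X : topologicalType) :
  second_countable X -> second_countable (upper_vietoris X).
Proof.
move=> /second_countableP[V [oV bV]]; apply/second_countableP.
pose G (s : seq nat) := \bigcup_(i in [set i | i \in s]) V i.
have oG s : open (G s) by apply: bigcup_open => i _; exact: oV.
(* Finite lists of indices are numbered by [pickle]; numbers coding no list get
   the empty union. *)
exists (fun n => box (G (odflt [::] (choice.unpickle n)))); split.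
  by move=> n; exact: open_box.
move=> K A /open_upper_vietorisP oA /oA[U [oU KU UA]].
have [_ /compactP cK _] := compact_satP (K : compact_sat X).
have [|||_ [s sU <-] Ks] := cK [set G s | s in [set s | G s `<=` U]].
- by move=> _ [s _ <-].
- split=> [|_ _ [s sU <-] [t tU <-]].
    by exists (G [::]), [::] => // x [].
  exists (G (s ++ t)).
    exists (s ++ t) => // x [i /=]; rewrite mem_cat => /orP[si|ti] Vx.
      by apply: sU; exists i.
    by apply: tU; exists i.
  by split=> x [i /= si Vx]; exists i => //=; rewrite mem_cat si ?orbT.
- move=> x Kx; have [i Vx VU] := bV x U oU (KU x Kx).
  exists (G [:: i]); last by exists i => //=; rewrite inE.
  by exists [:: i] => // y [j /=]; rewrite inE => /eqP ->; exact: VU.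
exists (choice.pickle s); rewrite choice.pickleK //=.
by move=> L Ls; apply: UA => x /Ls /sU.
Qed.

(** The limit Q of a sequence in A converging to all of A is its generic point:
    it lies in A because a box around Q contains terms of the sequence. *)
Lemma upper_vietoris_sober (X : topologicalType) :
  second_countable X -> well_filtered_space X ->
  sober_space (upper_vietoris X).
Proof.
move=> scX wf A cA iA.
have [K [AK KA]] := irreducible_cvg (upper_vietoris_second_countable scX) iA
  (@subset_closure _ A).
have [n U oU KU|Q QU] := @upper_limit_exists X K wf.
  exact: KA (AK n) (open_box oU) KU.
have AQ : A Q.
  apply: contrapT => nAQ.
  have /open_upper_vietorisP/(_ Q nAQ)[U [oU /(QU U oU)[N _ KU] UA]] :
    open (~` A) by rewrite openC.
  exact: (UA (K N) (KU N (leqnn N))) (AK N).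
have AE : A = closure [set (Q : upper_vietoris X)].
  apply/seteqP; split=> [L AL|]; last exact: closure1_subset.
  apply/closure1P => W /open_upper_vietorisP oW /oW[U [oU LU UW]].
  by apply: UW; apply/(QU U oU); exact: KA AL (open_box oU) LU.
exists Q; split=> // L; rewrite AE => QL; apply: val_inj; apply/seteqP.
by split; apply/closure1_upper_vietoris; [rewrite QL|rewrite -QL];
  exact: subset_closure.
Qed.

(** * The Scott topology on compact saturated sets *)

(** In a well-filtered space the supremum of a directed set is its intersection. *)
Lemma scott_open_box (X : topologicalType) (U : set X) :
  well_filtered_space X -> open U -> scott_open (box U).
Proof.
move=> wf oU; split=> [K L KU /smyth_leP LK|D S [D0 dD] [Sub Slub] SU].
  exact: subset_trans KU.
have fD : filtered_family D.
  split=> // K1 K2 /dD h /h[K3 DK3 [/smyth_leP K13 /smyth_leP K23]].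
  by exists K3.
have [Q QE] := well_filtered_bigcap wf fD.
have /smyth_leP QS : (S <= Q)%O.
  by apply: Slub => K DK; apply/smyth_leP; rewrite QE => x; apply.
have [|K DK KU] := wf.2 D U fD oU; first by rewrite -QE; exact: subset_trans SU.
by exists K.
Qed.

(** The upper Vietoris topology is detected by sequences, and the tails of a
    sequence converging to Q form a directed set with supremum Q, which Scott
    open sets can test. *)
Lemma scott_open_upper_vietoris (X : topologicalType)
    (A : set (compact_sat X)) :
  second_countable X -> scott_open A -> @open (upper_vietoris X) A.
Proof.
move=> scX [upA scA]; rewrite -[A]setCK openC => Q clQ AQ.
have [|K [nAK KQ]] := @irreducible_cvg (upper_vietoris X)
    (closure [set (Q : upper_vietoris X)]) (~` A)
    (upper_vietoris_second_countable scX) (irreducible_closure1 _).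
  by apply: closure1_subset => //; exact: closed_closure.
have KQ' : upper_cvg K Q.
  by move=> U oU QU; apply: (KQ Q _ _ (open_box oU) QU); exact: subset_closure.
have [L LE] := choice (fun n => limit_tail_compact_sat n KQ').
have [||_ [[n _ <-] ALn]] := scA (range L) Q _ _ AQ.
- split=> [|_ _ [m _ <-] [n _ <-]]; first by exists (L 0%N), 0%N.
  exists (L (maxn m n)); first by exists (maxn m n).
  by split; apply/smyth_leP; rewrite !LE; apply: limit_tail_decr;
    [exact: leq_maxl|exact: leq_maxr].
- split=> [_ [n _ <-]|M ubM]; first by apply/smyth_leP; rewrite LE; left.
  apply/smyth_leP => x Mx; apply: contrapT => nQx.
  have [_ _ sQ] := compact_satP Q.
  have [U [oU QU nUx]] := saturated_notin sQ nQx.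
  have [N _ KU] := KQ' U oU QU; apply: nUx.
  have /smyth_leP ML : (L N <= M)%O by apply: ubM; exists N.
  have := ML x Mx; rewrite LE => -[/QU//|[m Nm Kx]].
  exact: KU Nm _ Kx.
apply: (nAK n); apply: upA ALn _; apply/smyth_leP; rewrite LE => x Kx.
by right; exists n => //=.
Qed.

Lemma scott_upper_vietoris (X : topologicalType) :
  second_countable X -> well_filtered_space X ->
  scott_topology (compact_sat X) = upper_vietoris_topology X.
Proof.
move=> scX wf; apply/seteqP; split=> A; first exact: scott_open_upper_vietoris.
move=> /open_upper_vietorisP oA.
have -> : A = \bigcup_(U in [set U | open U /\ box U `<=` A]) box U.
  apply/seteqP; split=> [K /oA[U [oU KU UA]]|K [U [_ UA] /UA]//].
  by exists U.
apply: (@bigcup_open (scott_power_space X)) => U [oU _].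
exact: scott_open_box.
Qed.

(** The two topologies on compact saturated sets are distinct structures on the
    same carrier; properties pass from one to the other because they depend only
    on the open sets. *)
Lemma second_countable_open_eq (T : Type) (c1 c2 : Topological.axioms_ T) :
  @open (Topological.Pack c1) = @open (Topological.Pack c2) ->
  second_countable (Topological.Pack c1) ->
  second_countable (Topological.Pack c2).
Proof.
move=> o12 /second_countableP[V bV]; apply/second_countableP; exists V.
by move: bV; rewrite /base_seq o12.
Qed.

Lemma sober_open_eq (T : Type) (c1 c2 : Topological.axioms_ T) :
  @open (Topological.Pack c1) = @open (Topological.Pack c2) ->
  sober_space (Topological.Pack c1) -> sober_space (Topological.Pack c2).
Proof.
move=> o12.
have same_closed : @closed (Topological.Pack c1) = @closed (Topological.Pack c2).
  by apply/funext => A; apply/propext; rewrite -openC o12 openC.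
have same_closure : @closure (Topological.Pack c1) = @closure (Topological.Pack c2).
  apply/funext => A; apply/seteqP.
  by split=> x /closureP Ax; apply/closureP; move: Ax; rewrite o12.
by rewrite /sober_space /irreducible_set same_closed same_closure.
Qed.

Theorem corollary8p25 (X : topologicalType) (hX : second_countable X) :
  (well_filtered_space X <-> sober_space X) /\
  (well_filtered_space X ->
    scott_topology (compact_sat X) = upper_vietoris_topology X /\
    (second_countable (scott_power_space X) /\
     sober_space (scott_power_space X))).
Proof.
split=> [|wf].
  split; [exact: well_filtered_sober|exact: sober_well_filtered].
have SV := scott_upper_vietoris hX wf.
split=> //; split.
- apply: second_countable_open_eq (esym SV) _.
  exact: upper_vietoris_second_countable.
- apply: sober_open_eq (esym SV) _; exact: upper_vietoris_sober.
Qed.
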